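(* Let $I\subseteq\mathbb{R}[x_1,\dots,x_n]$ be a linear ideal and let $M_I$ be the associated oriented matroid on $[n]$. Then $\operatorname{Trop}^+V(I)=\widetilde{\mathcal{B}}^+(M_I)$.
   Context: A linear ideal is an ideal generated by (homogeneous) linear forms. Oriented matroid $M_I$: write each nonzero linear form $f\in I$ in the form $a_1x_{i_1}+\dots+a_mx_{i_m}=b_1x_{j_1}+\dots+b_px_{j_p}$ with all $a_s,b_t>0$ (i.e. $f$ is the left side minus the right side). $M_I$ is the oriented matroid on $[n]$ whose signed circuits are all the (inclusion-)minimal signed sets of the form $\{i_1\cdots i_m\,\bar j_1\cdots\bar j_p\}$, where $i_1,\dots,i_m$ are the positive elements and $j_1,\dots,j_p$ (barred) are the negative elements. Positive Bergman fan: for an oriented matroid $M$ on $[n]$, $\omega\in\mathbb{R}^n$ and a signed circuit $C$ of $M$, $\operatorname{in}_\omega(C)$ denotes the signed set of elements of $C$ of largest $\omega$-weight among the elements of $C$, with the signs they have in $C$. $M_\omega$ is the oriented matroid on $[n]$ whose signed circuits are the inclusion-minimal members (with respect to supports) of $\{\operatorname{in}_\omega(C) : C\text{ a signed circuit of }M\}$ (this is indeed an oriented matroid). An oriented matroid is acyclic if it has no all-positive signed circuit. The positive Bergman fan of $M$ is $\widetilde{\mathcal{B}}^+(M)=\{\omega\in\mathbb{R}^n : M_\omega\text{ is acyclic}\}$. Positive tropical variety: for $f=\sum c_i\mathbf{x}^{\mathbf{a}_i}\in\mathbb{R}[x_1,\dots,x_n]$, the initial form $\operatorname{in}_\omega(f)$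 is the sum of all terms $c_i\mathbf{x}^{\mathbf{a}_i}$ for which $\omega\cdot\mathbf{a}_i$ is maximal (among the terms occurring in $f$). The initial ideal $\operatorname{in}_\omega(I)$ is the ideal generated by $\operatorname{in}_\omega(f)$ for all $f\in I$. The positive tropical variety is $$\operatorname{Trop}^+V(I)=\{\omega\in\mathbb{R}^n : \operatorname{in}_\omega(I)\text{ contains no nonzero polynomial in }\mathbb{R}^+[x_1,\dots,x_n]\},$$ where $\mathbb{R}^+[x_1,\dots,x_n]$ denotes the polynomials all of whose nonzero coefficients are positive. *)

(* Defs.v *)
From mathcomp Require Import all_boot all_order all_algebra.
From mathcomp Require Import boolp classical_sets reals.
From mathcomp Require Import mpoly.

Set Implicit Arguments.
Unset Strict Implicit.
Unset Printing Implicit Defensive.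

Import Order.TTheory GRing.Theory Num.Theory.

Local Open Scope ring_scope.
Local Open Scope classical_set_scope.

Section Ideals.

Variables (R : realFieldType) (n : nat).

Record ideal := Ideal {
  ideal_carrier :> {mpoly R[n]} -> Prop;
  ideal0 : ideal_carrier 0;
  idealD : forall p q, ideal_carrier p -> ideal_carrier q ->
    ideal_carrier (p + q);
  idealM : forall p q, ideal_carrier q -> ideal_carrier (p * q)
}.

Definition ideal_span_set (S : set {mpoly R[n]}) : set {mpoly R[n]} :=
  [set p | exists2 s : seq ({mpoly R[n]} * {mpoly R[n]}),
     (forall c, c \in s -> S c.2) & p = \sum_(c <- s) c.1 * c.2].

Lemma ideal_span0 S : ideal_span_set S 0.
Proof. by exists [::]; rewrite ?big_nil. Qed.

Lemma ideal_spanD S p q :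
  ideal_span_set S p -> ideal_span_set S q -> ideal_span_set S (p + q).
Proof.
move=> [s hs ->] [t ht ->]; exists (s ++ t); last by rewrite big_cat.
by move=> c; rewrite mem_cat => /orP[/hs|/ht].
Qed.

Lemma ideal_spanM S p q : ideal_span_set S q -> ideal_span_set S (p * q).
Proof.
move=> [s hs ->]; exists [seq (p * c.1, c.2) | c <- s].
  by move=> c /mapP[d ds ->]; apply: (hs _ ds).
by rewrite big_map mulr_sumr; apply: eq_bigr => c _; rewrite mulrA.
Qed.

Definition ideal_span (S : set {mpoly R[n]}) : ideal :=
  Ideal (ideal_span0 S) (@ideal_spanD S) (@ideal_spanM S).

Definition linear_ideal (I : ideal) : Prop :=
  exists2 S : set {mpoly R[n]}, (forall f, S f -> f \is 1.-homog) &
    ideal_carrier I = ideal_span S.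

End Ideals.

Section PositiveTropicalVariety.

Variables (R : realFieldType) (n : nat).
Implicit Types (w : 'rV[R]_n) (f p : {mpoly R[n]}) (I : ideal R n).

Definition wdeg w (m : 'X_{1..n}) : R := \sum_(i < n) w 0 i * (m i)%:R.

Definition initial_form w f : {mpoly R[n]} :=
  \sum_(m <- msupp f | all (fun m' => wdeg w m' <= wdeg w m) (msupp f))
    f@_m *: 'X_[m].

Definition initial_ideal w I : ideal R n :=
  ideal_span [set initial_form w f | f in (I : set _)].

Definition pos_coeffs p : Prop := forall m, m \in msupp p -> 0 < p@_m.

Definition pos_trop I : set 'rV[R]_n :=
  [set w | ~ exists p, [/\ initial_ideal w I p, p != 0 & pos_coeffs p]].

End PositiveTropicalVariety.

(* [C i] is [Some true] if [i] is a positive element of [C], [Some false] if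
   it is a negative one, and [None] if [i] does not belong to [C]. *)
Definition signed_set (n : nat) := {ffun 'I_n -> option bool}.

Section SignedSets.

Variable n : nat.
Implicit Types (C D : signed_set n).

Definition spos C : {set 'I_n} := [set i | C i == Some true]%SET.
Definition sneg C : {set 'I_n} := [set i | C i == Some false]%SET.
Definition ssupp C : {set 'I_n} := [set i | C i != None]%SET.
Definition sopp C : signed_set n := [ffun i => omap negb (C i)].

Definition ssubset C D : bool :=
  (spos C \subset spos D) && (sneg C \subset sneg D).

Definition all_positive C : bool := sneg C == finset.set0.

Record oriented_matroid := OrientedMatroid {
  circuits : set (signed_set n);
  circuit_neq0 : forall C, circuits C -> ssupp C != finset.set0;
  circuit_opp : forall C, circuits C -> circuits (sopp C);
  circuit_incomp : forall C D, circuits C -> circuits D ->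
    ssupp C \subset ssupp D -> C = D \/ C = sopp D;
  circuit_elim : forall C D e, circuits C -> circuits D -> C <> sopp D ->
    e \in spos C -> e \in sneg D ->
    exists F, [/\ circuits F,
      spos F \subset (spos C :|: spos D) :\ e &
      sneg F \subset (sneg C :|: sneg D) :\ e]
}.

Definition acyclic (K : set (signed_set n)) : Prop :=
  ~ exists2 C, K C & all_positive C.

End SignedSets.

Section PositiveBergmanFan.

Variables (R : realFieldType) (n : nat).
Implicit Types (w : 'rV[R]_n) (M : oriented_matroid n) (C : signed_set n).

Definition initial_signed_set w C : signed_set n :=
  [ffun i => if [forall j in ssupp C, w 0 j <= w 0 i] then C i else None].

Definition initial_circuits w M : set (signed_set n) :=
  [set initial_signed_set w C | C in circuits M].

(* The signed circuits of M_w, kept as a bare set of signed sets: acyclicity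
   only refers to these. *)
Definition circuits_at w M : set (signed_set n) :=
  [set C | initial_circuits w M C /\
     forall D, initial_circuits w M D -> ~~ (ssupp D \proper ssupp C)].

Definition pos_bergman M : set 'rV[R]_n :=
  [set w | acyclic (circuits_at w M)].

End PositiveBergmanFan.

Section MatroidOfIdeal.

Variables (R : realFieldType) (n : nat) (I : ideal R n).
Implicit Types (f g h : {mpoly R[n]}) (C D : signed_set n).

Definition sign_of_form f : signed_set n :=
  [ffun i => if 0 < f@_U_(i) then Some true
             else if f@_U_(i) < 0 then Some false else None].

Definition form_signed_sets : set (signed_set n) :=
  [set C | exists f, [/\ I f, f \is 1.-homog, f != 0 & C = sign_of_form f]].

Definition matroid_circuits : set (signed_set n) :=
  [set C | form_signed_sets C /\
     forall D, form_signed_sets D -> ssubset D C -> D = C].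

Lemma spos_form f i : (i \in spos (sign_of_form f)) = (0 < f@_U_(i)).
Proof. by rewrite inE ffunE; case: ltgtP. Qed.

Lemma sneg_form f i : (i \in sneg (sign_of_form f)) = (f@_U_(i) < 0).
Proof. by rewrite inE ffunE; case: ltgtP. Qed.

Lemma ssupp_form f i : (i \in ssupp (sign_of_form f)) = (f@_U_(i) != 0).
Proof. by rewrite inE ffunE; case: ltgtP. Qed.

Lemma signed_setP C D : spos C = spos D -> sneg C = sneg D -> C = D.
Proof.
move=> /setP hp /setP hn; apply/ffunP=> i.
by move: (hp i) (hn i); rewrite !inE; case: (C i) (D i) => [[]|] [[]|].
Qed.

Lemma sopp_form f : sopp (sign_of_form f) = sign_of_form (- f).
Proof.
by apply/ffunP=> i; rewrite !ffunE mcoeffN oppr_gt0 oppr_lt0; case: ltgtP.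
Qed.

Lemma sign_formZ (t : R) f : 0 < t -> sign_of_form (t *: f) = sign_of_form f.
Proof.
move=> t0; apply/ffunP=> i; rewrite !ffunE mcoeffZ.
by rewrite pmulr_rgt0 // pmulr_rlt0.
Qed.

Lemma linear_form_neq0 f : f \is 1.-homog -> f != 0 -> exists i, f@_U_(i) != 0.
Proof.
move=> /dhomogP fh f0.
have m0 : mlead f \in msupp f by apply: mlead_supp.
have /eqP := fh _ m0; rewrite mdeg_eq1 => /existsP[i /eqP mi].
by exists i; rewrite -mi -mcoeff_msupp.
Qed.

Lemma ideal_comb f g (a b : R) : I f -> I g -> I (a *: f + b *: g).
Proof.
by move=> If Ig; apply: idealD; rewrite -mul_mpolyC; apply: idealM.
Qed.

Lemma form_comb f g (a b : R) : f \is 1.-homog -> g \is 1.-homog ->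
  a *: f + b *: g \is 1.-homog.
Proof. by move=> fh gh; apply: rpredD; apply: rpredZ. Qed.

Lemma ssubset_refl C : ssubset C C.
Proof. by rewrite /ssubset !subxx. Qed.

Lemma ssubset_trans C D E : ssubset C D -> ssubset D E -> ssubset C E.
Proof.
move=> /andP[p1 n1] /andP[p2 n2].
by rewrite /ssubset (fintype.subset_trans p1) // (fintype.subset_trans n1).
Qed.

Lemma ssubset_supp C D : ssubset C D -> ssupp C \subset ssupp D.
Proof.
move=> /andP[/fintype.subsetP hp /fintype.subsetP hn]; apply/fintype.subsetP=> i.
move: (hp i) (hn i); rewrite !inE.
by case: (C i) (D i) => [[]|] [[]|] //= h1 h2 _.
Qed.

Lemma ssubset_eq C D : ssubset C D -> (#|ssupp D| <= #|ssupp C|)%N -> C = D.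
Proof.
move=> CD le; have /eqP/setP eqs : ssupp C == ssupp D.
  by rewrite eqEcard ssubset_supp.
move: CD => /andP[/fintype.subsetP hp /fintype.subsetP hn]; apply/ffunP=> i.
move: (hp i) (hn i) (eqs i); rewrite !inE.
by case: (C i) (D i) => [[]|] [[]|] //= h1 h2 _;
  first [have := h1 isT | have := h2 isT].
Qed.

(* Hence minimality for inclusion of signed sets and minimality for inclusion
   of supports select the same members of [form_signed_sets]. *)
Lemma circuit_multiple f g : I f -> f \is 1.-homog ->
    matroid_circuits (sign_of_form f) ->
    I g -> g \is 1.-homog -> g != 0 ->
    ssupp (sign_of_form g) \subset ssupp (sign_of_form f) ->
  exists2 t : R, t != 0 & f = t *: g.
Proof.
move=> If fh [_ fmin].
have key g' : I g' -> g' \is 1.-homog ->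
    ssupp (sign_of_form g') \subset ssupp (sign_of_form f) ->
    (exists i, 0 < f@_U_(i) * g'@_U_(i)) ->
    exists2 t : R, t != 0 & f = t *: g'.
  move=> Ig' gh' /fintype.subsetP sgf [i0 i0P].
  pose P i := 0 < f@_U_(i) * g'@_U_(i).
  pose r i : R := f@_U_(i) / g'@_U_(i).
  case: (@arg_minP _ _ _ i0 P r i0P) => k Pk kmin.
  have gnz i : P i -> g'@_U_(i) != 0.
    by rewrite /P; case: eqP => // ->; rewrite mulr0 ltxx.
  have rpos i : P i -> 0 < r i.
    move=> Pi; have gi := gnz i Pi.
    have -> : r i = (f@_U_(i) * g'@_U_(i)) / g'@_U_(i) ^+ 2.
      by rewrite /r expr2 invfM mulrA mulfK.
    by rewrite divr_gt0 // exprn_even_gt0 //= gi orbT.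
  exists (r k); first by rewrite gt_eqF ?rpos.
  pose h := 1 *: f + (- r k) *: g'.
  have hE i : h@_U_(i) = f@_U_(i) - r k * g'@_U_(i).
    by rewrite mcoeffD !mcoeffZ mul1r mulNr.
  have [h0|hn0] := eqVneq h 0.
    by apply/eqP; rewrite -subr_eq0 -scaleNr -[X in X + _]scale1r -/h h0.
  exfalso.
  have hs : ssubset (sign_of_form h) (sign_of_form f).
    have rk := rpos k Pk.
    apply/andP; split; apply/fintype.subsetP=> i.
      rewrite !spos_form hE => hi.
      have [//|fi|fi] := ltgtP 0 (f@_U_(i)).
        have [gi|gi] := leP 0 (g'@_U_(i)).
          move: hi; rewrite ltNge -oppr_ge0 opprB subr_ge0.
          by rewrite (le_trans (ltW fi)) // mulr_ge0 // ltW.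
        have Pi : P i by rewrite /P nmulr_rgt0.
        have := kmin i Pi; rewrite /r -/(r k) ler_ndivlMr // => le.
        by move: hi; rewrite subr_gt0 ltNge le.
      have := sgf i; rewrite !ssupp_form -fi eqxx.
      case: eqP => [g0|_]; last by move=> /(_ isT).
      by move: hi; rewrite g0 -fi mulr0 subr0 ltxx.
    rewrite !sneg_form hE => hi.
    have [fi|//|fi] := ltgtP 0 (f@_U_(i)).
      have [gi|gi] := leP (g'@_U_(i)) 0.
        move: hi; rewrite ltNge subr_ge0.
        by rewrite (le_trans _ (ltW fi)) // mulr_ge0_le0 // ltW.
      have Pi : P i by rewrite /P pmulr_rgt0.
      have := kmin i Pi; rewrite /r -/(r k) ler_pdivlMr // => le.
      by move: hi; rewrite subr_lt0 ltNge le.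
    have := sgf i; rewrite !ssupp_form -fi eqxx.
    case: eqP => [g0|_]; last by move=> /(_ isT).
    by move: hi; rewrite g0 -fi mulr0 subr0 ltxx.
  have hV : form_signed_sets (sign_of_form h).
    by exists h; split => //; [apply: ideal_comb|apply: form_comb].
  have /ffunP/(_ k) := fmin _ hV hs.
  move=> /(congr1 isSome) e.
  have : k \in ssupp (sign_of_form h).
    rewrite inE; case: (sign_of_form h k) e => //= e.
    have : k \in ssupp (sign_of_form f).
      rewrite ssupp_form; move: Pk; rewrite /P.
      by case: eqP => // ->; rewrite mul0r ltxx.
    by rewrite inE; case: (sign_of_form f k) e.
  by rewrite ssupp_form hE /r divfK ?gnz // subrr eqxx.
move=> Ig gh g0 sgf.
have [i gi] := linear_form_neq0 gh g0.
have fi : f@_U_(i) != 0.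
  by rewrite -ssupp_form; apply: (fintype.subsetP sgf); rewrite ssupp_form.
have : f@_U_(i) * g@_U_(i) != 0 by rewrite mulf_neq0.
rewrite neq_lt => /orP[lt|gt]; last by apply: key => //; exists i.
have INg : I (- g) by rewrite -mulN1r; apply: idealM.
have [|||t t0 ->] := key _ INg.
- by rewrite rpredN.
- by rewrite -sopp_form; apply: fintype.subset_trans sgf; apply/fintype.subsetP=> j;
     rewrite !inE ffunE; case: (sign_of_form g j).
- by exists i; rewrite mcoeffN mulrN oppr_gt0.
by exists (- t); rewrite ?oppr_eq0 // scalerN scaleNr.
Qed.

Lemma matroid_circuit_neq0 C : matroid_circuits C -> ssupp C != finset.set0.
Proof.
move=> [[f [_ fh f0 ->]] _]; have [i fi] := linear_form_neq0 fh f0.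
by apply/set0Pn; exists i; rewrite ssupp_form.
Qed.

Lemma soppK C : sopp (sopp C) = C.
Proof. by apply/ffunP=> i; rewrite !ffunE; case: (C i) => [[]|]. Qed.

Lemma form_signed_sets_opp C : form_signed_sets C -> form_signed_sets (sopp C).
Proof.
move=> [f [If fh f0 ->]]; exists (- f); rewrite sopp_form rpredN oppr_eq0.
by split=> //; rewrite -mulN1r; apply: idealM.
Qed.

Lemma ssubset_opp C D : ssubset (sopp C) (sopp D) = ssubset C D.
Proof.
have pE E : spos (sopp E) = sneg E.
  by apply/setP=> i; rewrite !inE ffunE; case: (E i) => [[]|].
have nE E : sneg (sopp E) = spos E.
  by apply/setP=> i; rewrite !inE ffunE; case: (E i) => [[]|].
by rewrite /ssubset !pE !nE andbC.
Qed.

Lemma matroid_circuit_opp C : matroid_circuits C -> matroid_circuits (sopp C).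
Proof.
move=> [VC minC]; split; first exact: form_signed_sets_opp.
move=> D VD; rewrite -[D]soppK ssubset_opp => DC.
by rewrite (minC _ (form_signed_sets_opp VD) DC).
Qed.

Lemma matroid_circuit_incomp C D : matroid_circuits C -> matroid_circuits D ->
  ssupp C \subset ssupp D -> C = D \/ C = sopp D.
Proof.
move=> [[f [If fh f0 ->]] _] cD; have [[g [Ig gh g0 gE]] _] := cD.
rewrite {}gE in cD *; move=> /(circuit_multiple Ig gh cD If fh f0)[t t0 ->].
rewrite neq_lt in t0; case/orP: t0 => t0; [right|left].
  by rewrite sopp_form -scaleNr sign_formZ ?oppr_gt0.
by rewrite sign_formZ.
Qed.

Lemma circuit_below C : form_signed_sets C ->
  exists2 D, matroid_circuits D & ssubset D C.
Proof.
have [k] := ubnP #|ssupp C|; elim: k C => // k IH C ltk VC.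
have [[D [VD DC neqD]]|nex] := pselect (exists D,
    [/\ form_signed_sets D, ssubset D C & D <> C]); last first.
  exists C; last exact: ssubset_refl.
  by split=> // D VD DC; apply: contrapT => neqD; apply: nex; exists D.
have ltD : (#|ssupp D| < k)%N.
  rewrite ltnS in ltk; apply: leq_trans ltk; rewrite ltnNge; apply/negP => le.
  by apply: neqD; apply: ssubset_eq.
have [E cE ED] := IH D ltD VD.
by exists E => //; apply: ssubset_trans DC.
Qed.

Lemma matroid_circuit_elim C D e : matroid_circuits C -> matroid_circuits D ->
  C <> sopp D -> e \in spos C -> e \in sneg D ->
  exists F, [/\ matroid_circuits F,
    spos F \subset (spos C :|: spos D) :\ e &
    sneg F \subset (sneg C :|: sneg D) :\ e].
Proof.
move=> [[f [If fh f0 ->]] _] [[g [Ig gh g0 ->]] _].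
rewrite sopp_form spos_form sneg_form => neq fe ge.
pose h := (- g@_U_(e)) *: f + f@_U_(e) *: g.
have hE i : h@_U_(i) = - g@_U_(e) * f@_U_(i) + f@_U_(e) * g@_U_(i).
  by rewrite mcoeffD !mcoeffZ.
have nge : 0 < - g@_U_(e) by rewrite oppr_gt0.
have he : h@_U_(e) = 0 by rewrite hE mulNr mulrC addNr.
have hn0 : h != 0.
  apply/eqP => h0; apply: neq.
  rewrite -(sign_formZ f nge) -(sign_formZ (- g) fe).
  by congr sign_of_form; apply/eqP; rewrite scalerN -addr_eq0 -/h h0.
have hV : form_signed_sets (sign_of_form h).
  by exists h; split => //; [apply: ideal_comb|apply: form_comb].
have [F cF /andP[Fp Fn]] := circuit_below hV; exists F; split=> //.
  apply: (fintype.subset_trans Fp); apply/fintype.subsetP=> i.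
  rewrite finset.in_setD1 finset.in_setU !spos_form => hi; apply/andP; split.
    by apply: contraTneq hi => ->; rewrite he ltxx.
  rewrite -implyNb -leNgt; apply/implyP => fi; rewrite ltNge; apply/negP => gi.
  move: hi; rewrite ltNge hE -oppr_ge0 opprD addr_ge0 //.
    by rewrite oppr_ge0 mulr_ge0_le0 // ltW.
  by rewrite oppr_ge0 mulr_ge0_le0 // ltW.
apply: (fintype.subset_trans Fn); apply/fintype.subsetP=> i.
rewrite finset.in_setD1 finset.in_setU !sneg_form => hi; apply/andP; split.
  by apply: contraTneq hi => ->; rewrite he ltxx.
rewrite -implyNb -leNgt; apply/implyP => fi; rewrite ltNge; apply/negP => gi.
by move: hi; rewrite ltNge hE addr_ge0 // mulr_ge0 // ltW.
Qed.

Definition matroid_of_ideal : oriented_matroid n :=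
  OrientedMatroid matroid_circuit_neq0 matroid_circuit_opp
    matroid_circuit_incomp matroid_circuit_elim.

End MatroidOfIdeal.

(* Main.v *)
Require Import Defs.
From mathcomp Require Import all_boot all_order all_algebra.
From mathcomp Require Import boolp classical_sets reals.
From mathcomp Require Import mpoly.

(** Let [L] be the space of coefficient vectors of the linear forms of [I].

    The inclusion of the positive tropical variety in the Bergman fan is direct:
    if an initial circuit is all positive, it is the sign vector of the initial
    form of a linear form of [I], which then has positive coefficients
    ([pos_trop_sub_pos_bergman]).

    For the converse, the difficulty is that the initial ideal is generated by
    initial forms of arbitrary polynomials, not only of linear ones.  This is
    overcome by producing one point [v] with positive coordinates at which every
    initial form of [I] vanishes; a nonzero polynomial with positive
    coefficients does not vanish at [v].  Gaussian elimination that always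
    solves for a variable of largest weight gives a linear substitution [A] that
    kills [L], hence [I], changes every vector by an element of [L], and never
    increases weights ([weighted_reduction]).  Keeping only the
    weight-preserving entries of [A] gives a substitution [T]; comparing leading
    parts in [A f = 0] yields [T (initial_form f) = 0] for all [f] in [I]
    ([lsubst_initial_form]).  So any positive [v] with [T v = v] will do
    ([initial_form_vanishes]).  In terms of [t ^ w], the curve whose coordinates
    are those of [A (t ^ w v)] lies on the variety of [I] and has leading
    coefficients [v].

    As [T] is idempotent, Gordan's alternative ([gordan]) applied to its rows
    gives either such a [v], or a nonzero nonnegative [c] with [c T = 0].  In
    the second case, [c] restricted to a single weight is the leading part of
    an element of [L] ([positive_fixpoint_or_nonneg_lead]).  An element of [L]
    whose leading part in that weight is nonnegative, nonzero and of minimal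
    support, and among these one of minimal support itself, has the signs of a
    circuit, and its initial signed set is an all-positive circuit of the
    initial matroid ([nonneg_lead_circuit]). *)

Set Implicit Arguments.
Unset Strict Implicit.
Unset Printing Implicit Defensive.

Import Order.TTheory GRing.Theory Num.Theory.

Local Open Scope ring_scope.

Lemma exists_minimizer (T : Type) (P : T -> Prop) (mu : T -> nat) :
  (exists x, P x) ->
  exists2 x, P x & forall y, P y -> (mu x <= mu y)%N.
Proof.
move=> [x0 Px0]; have [k] := ubnP (mu x0); elim: k x0 Px0 => // k IH x Px xk.
have [[y Py yx]|nex] := pselect (exists2 y, P y & (mu y < mu x)%N).
  by apply: (IH y Py); apply: leq_trans yx _.
exists x => // y Py; rewrite leqNgt; apply/negP => yx.
by apply: nex; exists y.
Qed.

(** * Gordan's alternative *)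

Section Gordan.

Variable R : realFieldType.

Lemma small_perturbation n (a b : 'I_n -> R) : (forall i, 0 < a i) ->
  exists2 e : R, 0 < e & forall i, 0 < a i + e * b i.
Proof.
elim: n a b => [|n IH] a b apos; first by exists 1 => [//|[]].
have [e e0 he] := IH (fun i => a (lift ord0 i)) (fun i => b (lift ord0 i))
  (fun i => apos (lift ord0 i)).
have [b0|b0] := leP 0 (b ord0).
  exists e => // i; have [j ->|->] := unliftP ord0 i; first exact: he.
  by apply: ltr_wpDr => //; rewrite mulr_ge0 // ltW.
pose d := Num.min e (a ord0 / (- b ord0) / 2%:R).
have nb : 0 < - b ord0 by rewrite oppr_gt0.
have d0 : 0 < d by rewrite lt_min e0 !divr_gt0.
exists d => // i; have [j ->|->] := unliftP ord0 i.
  have [bj|bj] := leP 0 (b (lift ord0 j)).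
    by apply: ltr_wpDr => //; rewrite mulr_ge0 // ltW.
  apply: lt_le_trans (he j) _; rewrite lerD2l ler_nM2r //.
  by rewrite ge_min lexx.
rewrite -[b ord0]opprK mulrN subr_gt0.
apply: (@le_lt_trans _ _ (a ord0 / (- b ord0) / 2%:R * (- b ord0))).
  by rewrite ler_pM2r // ge_min lexx orbT.
rewrite mulrAC divfK ?gt_eqF // ltr_pdivrMr // mulr_natr mulr2n.
by rewrite ltrDl.
Qed.

(** Induction on the number of rows, splitting off the first row [a].  Take
    [y] positive on the other rows.  If [a y] is negative, adding positive
    multiples of [a] to the other rows makes them all orthogonal to [y]; a
    solution [z] for the corrected rows can then be shifted along [y] to become
    orthogonal to [a] without changing its values on them, and a small
    perturbation makes it positive on [a] too. *)
Lemma gordan n d (N : 'M[R]_(n, d)) :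
  (exists y : 'cV_d, forall i, 0 < (N *m y) i 0) \/
  (exists c : 'rV_n, [/\ forall i, 0 <= c 0 i, c != 0 & c *m N = 0]).
Proof.
elim: n d N => [|n IH] d N; first by left; exists 0 => -[].
pose a := row ord0 N.
have [a0|an0] := eqVneq a 0.
  right; exists (delta_mx 0 ord0); split=> [i||].
  - by rewrite mxE ler0n.
  - by apply/rV0Pn; exists ord0; rewrite mxE !eqxx oner_neq0.
  - by rewrite -rowE.
pose N' := row' ord0 N.
have N'E (u : 'cV_d) j : (N' *m u) j 0 = (N *m u) (lift ord0 j) 0.
  by rewrite !mxE; apply: eq_bigr => k _; rewrite mxE.
have aE (u : 'cV_d) : (a *m u) 0 0 = (N *m u) ord0 0.
  by rewrite !mxE; apply: eq_bigr => k _; rewrite mxE.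
(* [s] lists the multiples of [a] added to the remaining rows; the coefficient
   [c s] of [a] in the lifted relation collects them *)
have lift_rel (s : 'cV[R]_n) : (forall i, 0 <= s i 0) ->
    (exists c : 'rV_n, [/\ forall i, 0 <= c 0 i, c != 0 &
       c *m (N' + s *m a) = 0]) ->
    exists c : 'rV_n.+1, [/\ forall i, 0 <= c 0 i, c != 0 & c *m N = 0].
  move=> s0 [c [c0 cn0 cN]].
  pose c' : 'rV[R]_n.+1 :=
    \row_i (if unlift ord0 i is Some j then c 0 j else (c *m s) 0 0).
  exists c'; split=> [i||].
  - rewrite mxE; case: unliftP => [j _|_] //.
    by rewrite mxE; apply: sumr_ge0 => k _; apply: mulr_ge0.
  - have /rV0Pn[j cj] := cn0; apply/rV0Pn; exists (lift ord0 j).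
    by rewrite mxE liftK.
  - rewrite -cN; apply/rowP=> k; rewrite mulmxDr mulmxA [RHS]mxE addrC.
    rewrite [LHS]mxE big_ord_recl [c' _ _]mxE unlift_none; congr (_ + _).
      by rewrite [RHS]mxE big_ord_recl big_ord0 addr0 /a [row _ _ _ _]mxE.
    by rewrite [RHS]mxE; apply: eq_bigr => j _; rewrite !mxE liftK.
have perturb (z u : 'cV[R]_d) : (forall i, 0 < (N' *m z) i 0) ->
    (a *m z) 0 0 = 0 -> 0 < (a *m u) 0 0 ->
    exists y : 'cV_d, forall i, 0 < (N *m y) i 0.
  move=> Nz az au.
  have [e e0 he] := small_perturbation (fun i => (N' *m u) i 0) Nz.
  exists (z + e *: u) => i; rewrite mulmxDr -scalemxAr.
  have [j ->|->] := unliftP ord0 i.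
    by move: (he j); rewrite !N'E !mxE.
  by rewrite mxE -aE az add0r mxE -aE mulr_gt0.
have [[y yN]|rel] := IH d N'; last first.
  right; apply: (lift_rel 0) => [i|]; first by rewrite mxE.
  by rewrite mul0mx addr0.
have [ay|ay|ay] := ltgtP ((a *m y) 0 0) 0; last first.
- left; apply: (perturb y a^T) => //.
  rewrite mxE lt_neqAle eq_sym; apply/andP; split; last first.
    by apply: sumr_ge0 => k _; rewrite [a^T _ _]mxE -expr2 sqr_ge0.
  apply: contra an0; rewrite psumr_eq0 => [/allP h|k _]; last first.
    by rewrite [a^T _ _]mxE -expr2 sqr_ge0.
  apply/eqP/rowP => k; rewrite [RHS]mxE; apply/eqP.
  by have := h k (mem_index_enum _); rewrite [a^T _ _]mxE mulf_eq0 orbb.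
- left; exists y => i; have [j ->|->] := unliftP ord0 i.
    by rewrite -N'E.
  by rewrite -aE.
pose s : 'cV[R]_n := \col_i ((N' *m y) i 0 / - (a *m y) 0 0).
have nay : 0 < - (a *m y) 0 0 by rewrite oppr_gt0.
have s0 i : 0 <= s i 0 by rewrite mxE ltW // divr_gt0.
have [[z zN]|rel] := IH d (N' + s *m a); last by right; apply: lift_rel rel.
left; pose l := (a *m z) 0 0 / - (a *m y) 0 0.
have az : (a *m (z + l *: y)) 0 0 = 0.
  rewrite mulmxDr -scalemxAr mxE [X in _ + X]mxE /l.
  by rewrite -[X in _ * X]opprK mulrN divfK ?gt_eqF ?subrr.
apply: (perturb (z + l *: y) (- y)) => //; last first.
  by rewrite mulmxN mxE.
move=> i; suff -> : (N' *m (z + l *: y)) i 0 = ((N' + s *m a) *m z) i 0 by [].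
rewrite mulmxDr mulmxDl mxE [RHS]mxE; congr (_ + _).
rewrite -scalemxAr mxE -mulmxA [RHS]mxE big_ord_recl big_ord0 addr0.
by rewrite [s _ _]mxE /l mulrC mulrA mulrAC.
Qed.

End Gordan.

(** * Elimination adapted to a weight *)

Section WeightedReduction.

Variables (R : realFieldType) (n : nat) (w : 'rV[R]_n).
Variable L : 'rV[R]_n -> Prop.
Hypothesis Llin : forall (a : R) (u v : 'rV[R]_n), L u -> L v -> L (a *: u + v).

(** As a substitution sending the [i]-th variable to the form with coefficients
    [A i], such a matrix never increases weights. *)
Definition weight_lower (A : 'M[R]_n) :=
  forall i j, A i j != 0 -> w 0 j <= w 0 i.

Definition weight_part (A : 'M[R]_n) : 'M[R]_n :=
  \matrix_(i, j) (if w 0 j == w 0 i then A i j else 0).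

Lemma weight_lower_mul (A B : 'M[R]_n) :
  weight_lower A -> weight_lower B -> weight_lower (A *m B).
Proof.
move=> Alow Blow i j; rewrite mxE; apply: contraNle => ij.
apply/eqP/big1 => k _; apply/eqP; apply: contraLR ij; rewrite mulf_eq0 negb_or.
by move=> /andP[/Alow Aik /Blow Bkj]; rewrite -leNgt (le_trans Bkj).
Qed.

(** Along a path [i, k, j] of nonzero entries weights never increase, so if the
    two ends have equal weights then [k] has that weight too. *)
Lemma weight_part_mul (A B : 'M[R]_n) :
  weight_lower A -> weight_lower B ->
  weight_part (A *m B) = weight_part A *m weight_part B.
Proof.
move=> Alow Blow; apply/matrixP=> i j; rewrite !mxE.
case: eqP => [ij|nij].
  apply: eq_bigr => k _; rewrite !mxE.
  have [|ki] := eqVneq (w 0 k) (w 0 i); first by move=> ->; rewrite ij eqxx.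
  rewrite mul0r; apply/eqP; apply: contraNT ki; rewrite mulf_eq0 negb_or.
  by move=> /andP[/Alow Aik /Blow Bkj]; rewrite eq_le Aik -ij Bkj.
rewrite big1 // => k _; rewrite !mxE.
case: eqP => [ki|]; last by rewrite mul0r.
by case: eqP => [jk|]; [case: nij; rewrite jk | rewrite mulr0].
Qed.

(** A matrix of least rank among those satisfying the first two conditions
    satisfies the third: if [g = f A] were nonzero for some [f] in [L], then [g]
    would lie in [L], and eliminating with [g] a variable of largest weight
    would lower the rank. *)
Lemma weighted_reduction : L 0 -> exists A : 'M[R]_n,
  [/\ weight_lower A, forall u, L (u - u *m A) &
      forall u, L u -> u *m A = 0].
Proof.
move=> L0.
pose P (A : 'M[R]_n) := weight_lower A /\ forall u, L (u - u *m A).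
have [|A [Alow AL] Amin] := @exists_minimizer _ P (fun A => \rank A).
  exists 1%:M; split=> [i j|u]; last by rewrite mulmx1 subrr.
  by rewrite mxE; have [->|] := eqVneq i j; rewrite ?lexx ?eqxx.
exists A; split=> // f Lf; apply/eqP; apply: contraT => fA.
pose g := f *m A.
have Lg : L g.
  by rewrite -(subKr f g) -[f - (f - g)]addrC -scaleN1r; apply: Llin.
have [i0 gi0] : exists i, g 0 i != 0 by apply/rV0Pn.
have [i gi imax] := @arg_maxP _ _ _ i0 (fun i => g 0 i != 0) (w 0) gi0.
(* [E] solves [g = 0] for the variable [i] *)
pose E : 'M[R]_n := 1%:M - (g 0 i)^-1 *: (delta_mx i 0 *m g).
have gE : g *m E = 0.
  rewrite mulmxBr mulmx1 -scalemxAr mulmxA -colE.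
  have -> : col i g = (g 0 i)%:M by apply/rowP=> k; rewrite !ord1 !mxE eqxx.
  by rewrite mul_scalar_mx scalerA mulVf // scale1r subrr.
have EE k j : E k j = (k == j)%:R - (g 0 i)^-1 * ((k == i)%:R * g 0 j).
  by rewrite !mxE big_ord1 !mxE andbT.
have Elow : weight_lower E.
  move=> k j; rewrite EE; have [->|kj] := eqVneq k j; first by rewrite lexx.
  rewrite sub0r oppr_eq0 !mulf_eq0 !negb_or => /and3P[_ ki gj].
  have -> : k = i by apply/eqP; move: ki; case: (k == i) => //=; rewrite eqxx.
  exact: imax.
have AEL u : L (u - u *m (A *m E)).
  have -> : u - u *m (A *m E) =
      ((u *m A *m delta_mx i (0 : 'I_1)) 0 0 / g 0 i) *: g + (u - u *m A).
    rewrite mulmxA mulmxBr mulmx1 opprB addrCA; congr (_ + _).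
    rewrite -scalemxAr mulmxA; set x := _ *m delta_mx i 0.
    by rewrite [x]mx11_scalar mul_scalar_mx scalerA mulrC !mxE eqxx.
  exact: Llin.
have := Amin _ (conj (weight_lower_mul Alow Elow) AEL).
rewrite -{1}(mxrank_mul_ker A E) -{2}[\rank (A *m E)]addn0 leq_add2l leqn0.
rewrite mxrank_eq0 => /eqP cap0.
have : (g <= A :&: kermx E)%MS by rewrite sub_capmx submxMl; apply/sub_kermxP.
by rewrite cap0 submx0 (negPf fA).
Qed.

Definition nonneg_lead (W : R) (u : 'rV[R]_n) := [/\ L u,
  forall j, W < w 0 j -> u 0 j = 0,
  forall j, w 0 j = W -> 0 <= u 0 j &
  exists2 i, w 0 i = W & u 0 i != 0].

(** Since [A] is idempotent, so is its weight-preserving part [T], and [v] is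
    sought in the image of [T].  If Gordan's alternative instead gives
    [c T = 0], let [d] be the part of [c] of a given weight [W]: the entries of
    [d A] of weight at least [W] are those of [d T = 0], so [d] is the leading
    part of [d - d A], an element of [L]. *)
Lemma positive_fixpoint_or_nonneg_lead : L 0 ->
  (exists A : 'M[R]_n, exists v : 'cV[R]_n,
    [/\ weight_lower A, forall u, L u -> u *m A = 0,
        weight_part A *m v = v & forall i, 0 < v i 0]) \/
  (exists W u, nonneg_lead W u).
Proof.
move=> L0; have [A [Alow AL AK]] := weighted_reduction L0.
have AA : A *m A = A.
  apply/row_matrixP=> i; rewrite !rowE mulmxA; apply/esym/subr0_eq.
  by rewrite -mulmxBl; apply: AK (AL _).
have [[y ypos]|[c [c0 cn0 cA]]] := gordan (weight_part A).
  left; exists A, (weight_part A *m y); split=> //.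
  by rewrite mulmxA -weight_part_mul // AA.
right; have /rV0Pn[i0 ci0] := cn0.
pose W := w 0 i0.
pose d : 'rV[R]_n := \row_j (if w 0 j == W then c 0 j else 0).
have dA j : W <= w 0 j -> (d *m A) 0 j = 0.
  move=> Wj; rewrite mxE; have [jW|jW] := eqVneq (w 0 j) W.
    transitivity ((c *m weight_part A) 0 j); last by rewrite cA mxE.
    rewrite mxE; apply: eq_bigr => k _; rewrite !mxE jW eq_sym.
    by case: eqP; rewrite ?mul0r ?mulr0.
  apply: big1 => k _; rewrite !mxE; case: eqP => [kW|]; last by rewrite mul0r.
  have [->|/Alow jk] := eqVneq (A k j) 0; first by rewrite mulr0.
  by case/eqP: jW; apply/le_anti; rewrite Wj andbT -kW.
exists W, (d - d *m A); split=> [|j Wj|j jW|].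
- exact: AL.
- by rewrite mxE [X in _ + X]mxE dA ?ltW // oppr0 addr0 mxE gt_eqF.
- by rewrite mxE [X in _ + X]mxE dA ?jW // oppr0 addr0 mxE jW eqxx.
- exists i0 => //.
  by rewrite mxE [X in _ + X]mxE dA // oppr0 addr0 mxE eqxx.
Qed.

End WeightedReduction.

(** * Linear forms as coefficient vectors *)

Section LinearForms.

Variables (R : realFieldType) (n : nat).

Definition lform (u : 'rV[R]_n) : {mpoly R[n]} := \sum_i u 0 i *: 'X_i.

Lemma mcoeff_lform u i : (lform u)@_U_(i) = u 0 i.
Proof.
rewrite /lform raddf_sum (bigD1 i) //= mcoeffZ mcoeffXU eqxx mulr1.
rewrite big1 ?addr0 // => j /negPf ji.
by rewrite mcoeffZ mcoeffXU ji mulr0.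
Qed.

Lemma lform_homog u : lform u \is 1.-homog.
Proof.
by apply: rpred_sum => i _; apply: rpredZ; rewrite dhomogX; apply/eqP/mdeg1.
Qed.

Lemma lform_lin a u v : lform (a *: u + v) = a *: lform u + lform v.
Proof.
rewrite /lform scaler_sumr -big_split; apply: eq_bigr => i _ /=.
by rewrite !mxE scalerDl scalerA.
Qed.

Lemma lform0 : lform 0 = 0.
Proof. by rewrite /lform big1 // => i _; rewrite mxE scale0r. Qed.

Lemma homog1_coeff (f : {mpoly R[n]}) m :
  f \is 1.-homog -> m \in msupp f -> exists i, m = U_(i)%MM.
Proof.
move=> /dhomogP fh /fh /eqP; rewrite mdeg_eq1 => /existsP[i /eqP ->].
by exists i.
Qed.

Lemma homog1_lform (f : {mpoly R[n]}) :
  f \is 1.-homog -> exists u, f = lform u.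
Proof.
move=> fh; exists (\row_i f@_U_(i)); apply/mpolyP => m.
have [/existsP[i /eqP ->]|m1] := boolP [exists i, m == U_(i)%MM].
  by rewrite mcoeff_lform mxE.
rewrite -mdeg_eq1 in m1.
have out (g : {mpoly R[n]}) : g \is 1.-homog -> g@_m = 0.
  move=> gh; apply/eqP; rewrite mcoeff_eq0; apply: contra m1 => mg.
  by have [i ->] := homog1_coeff gh mg; rewrite mdeg1.
by rewrite !out // lform_homog.
Qed.

End LinearForms.

(** * Leading parts and linear substitutions *)

Section LeadingParts.

Variables (R : realFieldType) (n : nat) (w : 'rV[R]_n).
Implicit Types (f g h : {mpoly R[n]}) (W : R).

(** Unlike the initial form of a nonzero [g], the leading part [h] in weight [W]
    may be zero; this makes the relation compatible with sums. *)
Definition has_lead W g h :=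
  (forall m, m \in msupp h -> wdeg w m = W) /\
  (forall m, m \in msupp (g - h) -> wdeg w m < W).

Lemma wdegD m1 m2 : wdeg w (m1 + m2)%MM = wdeg w m1 + wdeg w m2.
Proof.
by rewrite -big_split; apply: eq_bigr => i _ /=; rewrite mnmDE natrD mulrDr.
Qed.

Lemma wdegU i : wdeg w U_(i)%MM = w 0 i.
Proof.
rewrite /wdeg (bigD1 i) //= mnm1E eqxx mulr1 big1 ?addr0 // => j ji.
by rewrite mnm1E eq_sym (negPf ji) mulr0.
Qed.

Lemma has_lead0 W : has_lead W 0 0.
Proof. by split=> m; rewrite ?subr0 msupp0. Qed.

Lemma has_leadD W g h g' h' :
  has_lead W g h -> has_lead W g' h' -> has_lead W (g + g') (h + h').
Proof.
move=> [hW gW] [hW' gW']; split=> m; last rewrite opprD addrACA.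
  by move/msuppD_le; rewrite mem_cat => /orP[/hW|/hW'].
by move/msuppD_le; rewrite mem_cat => /orP[/gW|/gW'].
Qed.

Lemma has_leadZ W a g h : has_lead W g h -> has_lead W (a *: g) (a *: h).
Proof.
move=> [hW gW]; split=> m; first by move/msuppZ_le/hW.
by rewrite -scalerBr => /msuppZ_le/gW.
Qed.

Lemma has_lead_sum (T : eqType) (s : seq T) (F G : T -> {mpoly R[n]}) W :
  (forall x, x \in s -> has_lead W (F x) (G x)) ->
  has_lead W (\sum_(x <- s) F x) (\sum_(x <- s) G x).
Proof.
elim: s => [|x s IH] FG; first by rewrite !big_nil; apply: has_lead0.
rewrite !big_cons; apply: has_leadD; first by apply: FG; rewrite mem_head.
by apply: IH => y ys; apply: FG; rewrite in_cons ys orbT.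
Qed.

Lemma has_lead_le W g h :
  has_lead W g h -> forall m, m \in msupp g -> wdeg w m <= W.
Proof.
move=> [hW gW] m; rewrite -[g](subrK h) => /msuppD_le.
by rewrite mem_cat => /orP[/gW/ltW|/hW ->].
Qed.

Lemma has_leadM W W' g h g' h' :
  has_lead W g h -> has_lead W' g' h' -> has_lead (W + W') (g * g') (h * h').
Proof.
move=> gh gh'; have [hW gW] := gh; have [hW' gW'] := gh'; split=> m.
  by move/msuppM_le/allpairsP=> [[a b] /= [/hW <- /hW' <- ->]]; rewrite wdegD.
have -> : g * g' - h * h' = (g - h) * g' + h * (g' - h').
  by rewrite mulrBl mulrBr addrA subrK.
move/msuppD_le; rewrite mem_cat => /orP[] /msuppM_le/allpairsP[[a b] /=].
  by case=> /gW aW /(has_lead_le gh') bW ->; rewrite wdegD ltr_leD.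
by case=> /hW aW /gW' bW ->; rewrite wdegD aW ltrD2l.
Qed.

Lemma has_lead_lower W g :
  (forall m, m \in msupp g -> wdeg w m < W) -> has_lead W g 0.
Proof. by move=> gW; split=> m; rewrite ?subr0 ?msupp0 //; apply: gW. Qed.

Lemma has_lead_of_zero W h : has_lead W 0 h -> h = 0.
Proof.
move=> [hW]; rewrite sub0r => lo; apply/eqP; rewrite -msupp_eq0.
case E: (msupp h) => [//|m s]; have mh : m \in msupp h by rewrite E mem_head.
by have := lo m; rewrite (perm_mem (msuppN _)) hW // ltxx => /(_ mh).
Qed.

Variable A : 'M[R]_n.
Hypothesis Alow : weight_lower w A.

Definition lsubst (B : 'M[R]_n) : {mpoly R[n]} -> {mpoly R[n]} :=
  mmap (@mpolyC n R) (fun i => lform (row i B)).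

Lemma lsubst_lform (B : 'M[R]_n) u : lsubst B (lform u) = lform (u *m B).
Proof.
rewrite /lsubst {1}/lform raddf_sum /=.
under eq_bigr => i _ do rewrite mmapZ mmapX mmap1U mul_mpolyC.
rewrite /lform; under eq_bigr => i _ do rewrite scaler_sumr.
rewrite exchange_big; apply: eq_bigr => j _ /=; rewrite mxE scaler_suml.
by apply: eq_bigr => i _; rewrite mxE scalerA.
Qed.

Lemma lsubst_lead_var i :
  has_lead (w 0 i) (lform (row i A)) (lform (row i (weight_part w A))).
Proof.
split=> m.
  move=> mA; have [j mj] := homog1_coeff (lform_homog _) mA.
  move: mA; rewrite mj mcoeff_msupp mcoeff_lform !mxE wdegU.
  by have [|_] := eqVneq (w 0 j) (w 0 i); rewrite ?eqxx.
have -> : lform (row i A) - lform (row i (weight_part w A)) =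
    lform (- 1 *: row i (weight_part w A) + row i A).
  by rewrite lform_lin scaleN1r addrC.
move=> mA; have [j mj] := homog1_coeff (lform_homog _) mA.
move: mA; rewrite mj mcoeff_msupp mcoeff_lform !mxE wdegU mulN1r.
have [_|ji] := eqVneq (w 0 j) (w 0 i); first by rewrite addNr eqxx.
by rewrite oppr0 add0r lt_neqAle ji => /Alow.
Qed.

Lemma lsubst_lead_monomial m : has_lead (wdeg w m)
  (mmap1 (fun i => lform (row i A)) m)
  (mmap1 (fun i => lform (row i (weight_part w A))) m).
Proof.
have lead1 : has_lead 0 1 1.
  split=> k; last by rewrite subrr msupp0.
  rewrite mcoeff_msupp mcoeff1.
  have [-> _|_] := eqVneq k 0%MM; last by rewrite eqxx.
  by rewrite /wdeg big1 // => i _; rewrite mnm0E mulr0.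
rewrite /wdeg /mmap1; elim/big_rec3: _ => [|i g W h _ IH]; first exact: lead1.
apply: has_leadM IH.
elim: (m i) => [|k IHk]; first by rewrite mulr0 !expr0.
rewrite -natr1 mulrDr mulr1 !exprSr.
exact: has_leadM IHk (lsubst_lead_var i).
Qed.

(** As [A] never increases weights, only the monomials of [f] of top weight can
    contribute to the part of [lsubst A f] in that weight. *)
Lemma lsubst_initial_form f :
  lsubst A f = 0 -> lsubst (weight_part w A) (initial_form w f) = 0.
Proof.
have [->|f0] := eqVneq f 0.
  by move=> _; rewrite /initial_form msupp0 big_nil /lsubst mmap0.
pose top m := all (fun m' => wdeg w m' <= wdeg w m) (msupp f).
have [M Mf Mtop] : exists2 M, M \in msupp f & top M.
  case E: (msupp f) => [|m0 s]; first by move: f0; rewrite -msupp_eq0 E.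
  have m0f : m0 \in msupp f by rewrite E mem_head.
  have [m _ mmax] := @arg_maxP _ _ _ (SeqSub m0f)
    xpredT (fun m => wdeg w (val m)) isT.
  exists (val m); first by rewrite -E (valP m).
  by apply/allP => k kf; apply: (mmax (SeqSub kf) isT).
move=> Af; apply: (@has_lead_of_zero (wdeg w M)); rewrite -Af.
rewrite /lsubst /initial_form raddf_sum big_mkcond {1}/mmap.
apply: has_lead_sum => m mf; rewrite mul_mpolyC.
have [/allP mtop|ntop] := boolP (all _ _).
  have -> : wdeg w M = wdeg w m.
    by apply/le_anti; rewrite mtop // (allP Mtop).
  rewrite /= mmapZ mmapX mul_mpolyC; apply: has_leadZ.
  exact: lsubst_lead_monomial.
apply: has_lead_lower => k /msuppZ_le kg.
apply: le_lt_trans (has_lead_le (lsubst_lead_monomial m) kg) _.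
have /allPn[m' m'f] := ntop; rewrite -ltNge => /lt_le_trans; apply.
exact: (allP Mtop).
Qed.

Variable v : 'cV[R]_n.

Lemma meval_lsubst B f : B *m v = v ->
  (lsubst B f).@[fun i => v i 0] = f.@[fun i => v i 0].
Proof.
move=> Bv; rewrite /lsubst {1}/mmap raddf_sum [RHS]mevalE.
apply: eq_bigr => m _ /=; rewrite mevalM mevalC rmorph_prod /=.
congr (_ * _); apply: eq_bigr => i _; rewrite rmorphXn /=; congr (_ ^+ _).
rewrite /lform raddf_sum /= -{2}Bv mxE; apply: eq_bigr => j _.
by rewrite mevalZ mevalXU mxE.
Qed.

Lemma initial_form_vanishes f : weight_part w A *m v = v -> lsubst A f = 0 ->
  (initial_form w f).@[fun i => v i 0] = 0.
Proof.
by move=> Av /lsubst_initial_form fA; rewrite -(meval_lsubst _ Av) fA meval0.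
Qed.

End LeadingParts.

Lemma pos_coeffs_meval_gt0 (R : realFieldType) n (p : {mpoly R[n]}) v :
  p != 0 -> pos_coeffs p -> (forall i, 0 < v i) -> 0 < p.@[v].
Proof.
move=> p0 ppos vpos; rewrite mevalE.
have term m : m \in msupp p -> 0 < p@_m * \prod_i v i ^+ m i.
  by move=> mp; rewrite mulr_gt0 ?ppos ?prodr_gt0 // => i _; rewrite exprn_gt0.
case E: (msupp p) => [|m s]; first by move: p0; rewrite -msupp_eq0 E.
rewrite big_cons ltr_pwDl ?term ?E ?mem_head // big_seq sumr_ge0 // => k ks.
by rewrite ltW // term // E in_cons ks orbT.
Qed.

(** * Initial forms and initial circuits *)

Section InitialCircuits.

Variables (R : realFieldType) (n : nat) (I : ideal R n) (w : 'rV[R]_n).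
Implicit Types (u h : 'rV[R]_n) (W : R).

Definition linear_part (u : 'rV[R]_n) : Prop := I (lform u).

Local Notation L := linear_part.
Local Notation sgn u := (sign_of_form (lform u)).

Lemma ideal_lform_lin (a : R) (u v : 'rV[R]_n) : L u -> L v -> L (a *: u + v).
Proof.
move=> Lu Lv; rewrite /linear_part lform_lin -[lform v]scale1r.
exact: ideal_comb.
Qed.

Lemma ssupp_sgn u i : (i \in ssupp (sgn u)) = (u 0 i != 0).
Proof. by rewrite ssupp_form mcoeff_lform. Qed.

Lemma initial_signed_setE (C : signed_set n) i :
  initial_signed_set w C i =
    if [forall j in ssupp C, w 0 j <= w 0 i] then C i else None.
Proof. by rewrite ffunE. Qed.

Definition wsupp W (u : 'rV[R]_n) : {set 'I_n} :=
  [set i | (w 0 i == W) && (u 0 i != 0)]%SET.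

Lemma initial_sgn W u i :
  (forall j, W < w 0 j -> u 0 j = 0) -> (exists2 k, w 0 k = W & u 0 k != 0) ->
  initial_signed_set w (sgn u) i = if w 0 i == W then sgn u i else None.
Proof.
move=> uW [k kW uk]; rewrite initial_signed_setE.
have uW' j : u 0 j != 0 -> w 0 j <= W by apply: contraNle => /uW ->.
case: forall_inP => [top|ntop]; case: eqP => // iW.
  have := top k; rewrite ssupp_sgn uk => /(_ isT); rewrite kW => Wi.
  rewrite ffunE mcoeff_lform uW ?ltxx // lt_neqAle Wi andbT.
  by rewrite eq_sym; apply/eqP.
by case: ntop => j; rewrite ssupp_sgn iW => /uW'.
Qed.

Lemma ssupp_initial_sgn W u :
  (forall j, W < w 0 j -> u 0 j = 0) -> (exists2 k, w 0 k = W & u 0 k != 0) ->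
  ssupp (initial_signed_set w (sgn u)) = wsupp W u.
Proof.
move=> uW uk; apply/setP=> i; rewrite !inE (initial_sgn _ uW uk).
case: (w 0 i == W) => //=.
by rewrite -(ssupp_sgn u) inE.
Qed.

Lemma max_weight (u : 'rV[R]_n) : u != 0 ->
  exists W, (forall j, W < w 0 j -> u 0 j = 0) /\
    exists2 k, w 0 k = W & u 0 k != 0.
Proof.
move=> /rV0Pn[i0 ui0].
have [i ui imax] := @arg_maxP _ _ _ i0 (fun i => u 0 i != 0) (w 0) ui0.
exists (w 0 i); split; last by exists i.
by move=> j ij; apply/eqP; apply: contraTT ij => /imax; rewrite -leNgt.
Qed.

(** Let [u] minimize the size of the support of its leading part, then that of
    its own support.  If a form [h] of [L] had its signs properly contained in
    those of [u], then either [h] has a nonzero part of weight [W], nonnegative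
    by conformity, and is itself smaller, or subtracting a multiple of [h] from
    [u] shrinks the support without touching the leading part; so [u] has the
    signs of a circuit.  If the leading part of some [h] had support properly
    contained in that of [u], subtracting the largest multiple of [h] or [- h]
    that keeps the leading part of [u] nonnegative would shrink its support. *)
Lemma nonneg_lead_circuit W u0 : nonneg_lead w L W u0 ->
  exists2 C, circuits_at w (matroid_of_ideal I) C & all_positive C.
Proof.
move=> Nu0.
(* lexicographic: the support of [u] has at most [n] elements *)
pose mu u := (#|wsupp W u| * n.+1 + #|ssupp (sgn u)|)%N.
have [u [Lu uW upos [k kW uk]] umin] :=
  exists_minimizer (P := nonneg_lead w L W) mu (ex_intro _ u0 Nu0).
have umin1 h : nonneg_lead w L W h -> wsupp W h \subset wsupp W u ->
    (#|ssupp (sgn h)| < #|ssupp (sgn u)|)%N -> False.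
  move=> Nh /subset_leq_card hu lt; have := umin h Nh; rewrite leqNgt /mu.
  by rewrite -addnS leq_add // leq_mul2r hu orbT.
have umin2 h : nonneg_lead w L W h -> wsupp W h \proper wsupp W u -> False.
  move=> Nh /proper_card hu; have := umin h Nh; rewrite leqNgt /mu.
  have : (#|ssupp (sgn h)| < n.+1)%N.
    by rewrite ltnS -[X in (_ <= X)%N]card_ord max_card.
  rewrite -(ltn_add2l (#|wsupp W h| * n.+1)) -mulSnr => /leq_trans -> //.
  by rewrite (leq_trans _ (leq_addr _ _)) // leq_mul2r hu orbT.
have scale_in h t : L h -> L (u - t *: h).
  by move=> Lh; rewrite addrC -scaleNr; apply: ideal_lform_lin.
have un0 : lform u != 0.
  by apply/eqP=> u0'; move: uk; rewrite -mcoeff_lform u0' mcoeff0 eqxx.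
have cu : matroid_circuits I (sgn u).
  split; first by exists (lform u); split=> //; apply: lform_homog.
  move=> D [f [If fh f0 DE]] Du.
  have [h fE] := homog1_lform fh; rewrite {}DE {f fh}fE in If f0 Du *.
  apply/ssubset_eq => //; rewrite leqNgt; apply/negP => lt.
  have /fintype.subsetP sub := ssubset_supp Du.
  have hu i : h 0 i != 0 -> u 0 i != 0.
    by move=> hi; rewrite -ssupp_sgn; apply: sub; rewrite ssupp_sgn.
  have [[i iW hi]|nex] := pselect (exists2 i, w 0 i = W & h 0 i != 0).
    apply: (umin1 h) lt; last first.
      by apply/fintype.subsetP=> j; rewrite !inE => /andP[-> /hu].
    split=> // [j /uW uj|j jW|]; last by exists i.
      by apply/eqP; apply: contraTT isT => /hu; rewrite uj eqxx.
    rewrite leNgt; apply/negP => hj; have /andP[_ /fintype.subsetP neg] := Du.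
    have := neg j; rewrite !sneg_form !mcoeff_lform hj => /(_ isT).
    by rewrite ltNge upos.
  have hW j : w 0 j = W -> h 0 j = 0.
    by move=> jW; apply/eqP; apply: contrapT => /negP hj; apply: nex; exists j.
  have [i hi] := linear_form_neq0 (lform_homog h) f0.
  rewrite mcoeff_lform in hi.
  pose g := u - (u 0 i / h 0 i) *: h.
  have gE j : g 0 j = u 0 j - u 0 i / h 0 i * h 0 j by rewrite !mxE.
  have gW j : w 0 j = W -> g 0 j = u 0 j.
    by move=> jW; rewrite gE (hW j) // mulr0 subr0.
  have h_sub j : u 0 j = 0 -> h 0 j = 0.
    by move=> uj; apply/eqP; apply: contraTT isT => /hu; rewrite uj eqxx.
  apply: (umin1 g).
  - split=> [|j jW|j jW|]; first exact: scale_in.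
    + by rewrite gE (h_sub j (uW j jW)) uW // mulr0 subr0.
    + by rewrite gW // upos.
    + by exists k; rewrite ?gW.
  - apply/fintype.subsetP=> j; rewrite !inE => /andP[/eqP jW].
    by rewrite gW // jW eqxx.
  apply/proper_card/properP; split.
    apply/fintype.subsetP=> j; rewrite !ssupp_sgn; apply: contra => /eqP uj.
    by rewrite gE (h_sub j) // uj mulr0 subr0.
  exists i; first by rewrite ssupp_sgn hu.
  by rewrite ssupp_sgn gE divfK // subrr eqxx.
have uk' : exists2 k, w 0 k = W & u 0 k != 0 by exists k.
exists (initial_signed_set w (sgn u)); last first.
  apply/eqP/setP => i; rewrite !inE (initial_sgn _ uW uk').
  have [iW|//] := eqVneq (w 0 i) W; rewrite ffunE mcoeff_lform.
  by case: ltgtP (upos _ iW).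
split; first by exists (sgn u).
move=> _ [D [[f [If fh f0 ->]] _] <-]; have [h fE] := homog1_lform fh.
rewrite {f fh}fE in If f0 *; apply/negP.
have hn0 : h != 0 by apply: contra f0 => /eqP ->; rewrite lform0.
have [V [hV hk]] := max_weight hn0.
rewrite (ssupp_initial_sgn uW uk') (ssupp_initial_sgn hV hk).
have {uk'} [j jV hj] := hk => prop.
have VW : V = W.
  have /fintype.subsetP/(_ j) := proper_sub prop.
  by rewrite !inE jV eqxx hj => /(_ isT)/andP[/eqP].
rewrite {}VW {V} in hV hk jV prop.
(* up to replacing [h] by [- h], one of its leading coefficients is positive *)
have {j jV hj hk f0 hn0} : exists h, [/\ L h, forall j, W < w 0 j -> h 0 j = 0,
    wsupp W h \proper wsupp W u & exists2 j, w 0 j = W & 0 < h 0 j].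
  move: hj; rewrite neq_lt => /orP[hj|hj].
    2: by exists h; split=> //; exists j.
  have wN : wsupp W (- h) = wsupp W h.
    by apply/setP=> i; rewrite !inE mxE oppr_eq0.
  exists (- h); split=> [|i /hV hi||]; last 2 first.
  - by rewrite wN.
  - by exists j => //; rewrite mxE oppr_gt0.
  - by rewrite -scaleN1r -[_ *: _]addr0; apply: ideal_lform_lin => //;
      rewrite /linear_part lform0; apply: ideal0.
  - by rewrite mxE hi oppr0.
move=> {h If hV prop} [h [Lh hW /properP[]]].
move=> /fintype.subsetP hsub [l lu lh] [j jW hj].
have hu i : w 0 i = W -> h 0 i != 0 -> u 0 i != 0.
  by move=> iW hi; have := hsub i; rewrite !inE iW eqxx => /(_ hi).
pose P i := (w 0 i == W) && (0 < h 0 i).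
have Pj : P j by rewrite /P jW eqxx.
have [i /andP[/eqP iW hi] imin] :=
  @arg_minP _ _ _ j P (fun i => u 0 i / h 0 i) Pj.
pose t := u 0 i / h 0 i.
have t0 : 0 <= t by rewrite divr_ge0 ?upos // ltW.
have gE m : (u - t *: h) 0 m = u 0 m - t * h 0 m by rewrite !mxE.
move: lu lh; rewrite !inE => /andP[/eqP lW ul].
rewrite lW eqxx negbK => /eqP hl.
apply: (umin2 (u - t *: h)).
  split=> [|m mW|m mW|]; first exact: scale_in.
  - by rewrite gE uW // (hW m) // mulr0 subr0.
  - rewrite gE; have [hm|hm] := leP (h 0 m) 0.
      by rewrite subr_ge0 (le_trans _ (upos _ mW)) // mulr_ge0_le0.
    rewrite subr_ge0 -ler_pdivlMr //; apply: imin.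
    by rewrite /P mW eqxx.
  - by exists l; rewrite // gE hl mulr0 subr0.
apply/properP; split.
  apply/fintype.subsetP=> m; rewrite !inE gE => /andP[/eqP mW].
  rewrite mW eqxx /=.
  apply: contra => /eqP um; rewrite um sub0r oppr_eq0.
  have [->|/(hu _ mW)] := eqVneq (h 0 m) 0; first by rewrite mulr0.
  by rewrite um eqxx.
exists i; first by rewrite inE iW eqxx hu // gt_eqF.
by rewrite inE gE /t divfK ?subrr ?eqxx ?andbF // (gt_eqF hi).
Qed.

Lemma mcoeff_initial_form (f : {mpoly R[n]}) m : (initial_form w f)@_m =
  if (m \in msupp f) && all (fun m' => wdeg w m' <= wdeg w m) (msupp f)
  then f@_m else 0.
Proof.
rewrite /initial_form raddf_sum /=.
under eq_bigr => k _ do rewrite mcoeffZ mcoeffX.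
have [mf|mf] /= := boolP (m \in _); last first.
  rewrite big_seq_cond big1 // => k /andP[kf _].
  by case: eqP kf mf => [-> ->|]; rewrite ?mulr0.
rewrite big_mkcond (bigD1_seq m) //= eqxx mulr1 big1 ?addr0 // => k /negPf km.
by rewrite km mulr0 if_same.
Qed.

Lemma pos_trop_sub_pos_bergman :
  pos_trop I w -> pos_bergman (matroid_of_ideal I) w.
Proof.
move=> tw [_ [[_ [[f [If fh f0 ->]] _] <-] _] /eqP/setP Cpos]; apply: tw.
have [u fE] := homog1_lform fh; rewrite {f fh}fE in If f0 Cpos.
have un0 : u != 0 by apply: contra f0 => /eqP ->; rewrite lform0.
have msupp_u m : m \in msupp (lform u) -> exists2 i, m = U_(i)%MM & u 0 i != 0.
  move=> mu; have [i mi] := homog1_coeff (lform_homog u) mu.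
  by exists i => //; rewrite -mcoeff_lform -mcoeff_msupp -mi.
have [W [uW [k kW uk]]] := max_weight un0.
exists (initial_form w (lform u)); split.
- exists [:: (1, initial_form w (lform u))]; last by rewrite big_seq1 mul1r.
  by move=> c; rewrite inE => /eqP ->; exists (lform u).
- apply/eqP => /mpolyP/(_ U_(k)%MM); rewrite mcoeff_initial_form mcoeff0.
  rewrite mcoeff_msupp mcoeff_lform uk /= ifT => [/eqP|].
    by rewrite (negPf uk).
  apply/allP => _ /msupp_u[j -> uj]; rewrite !wdegU kW.
  by move: uj; apply: contraNle => /uW ->.
move=> m; rewrite mcoeff_msupp mcoeff_initial_form.
case: ifP => [/andP[/msupp_u[i -> ui] /allP top]|]; last by rewrite eqxx.
rewrite mcoeff_lform => _; rewrite lt_neqAle eq_sym ui leNgt /=.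
apply/negP => uneg.
have := Cpos i; rewrite !inE initial_signed_setE ifT => [/negbT|].
  by rewrite ffunE mcoeff_lform uneg ltNge ltW.
apply/forall_inP => j.
rewrite ssupp_sgn -(wdegU w j) -(wdegU w i) => uj; apply: top.
by rewrite mcoeff_msupp mcoeff_lform.
Qed.

Lemma pos_bergman_sub_pos_trop : linear_ideal I ->
  pos_bergman (matroid_of_ideal I) w -> pos_trop I w.
Proof.
move=> [S Shom IS] acyc [p [[s sI pE] p0 ppos]].
have L0 : L 0 by rewrite /linear_part lform0; apply: ideal0.
have [[A [v [Alow AK Av vpos]]]|[W [u /nonneg_lead_circuit]]] :=
  positive_fixpoint_or_nonneg_lead w ideal_lform_lin L0; last exact: acyc.
have IK f : I f -> lsubst A f = 0.
  rewrite IS => -[r rS ->]; rewrite /lsubst raddf_sum big_seq big1 // => c cr.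
  rewrite /= rmorphM /= -/(lsubst A _) -/(lsubst A _).
  have Sc := rS _ cr; have [u cE] := homog1_lform (Shom _ Sc).
  have Lu : L u.
    rewrite /linear_part -cE IS; exists [:: (1, c.2)].
      2: by rewrite big_seq1 mul1r.
    by move=> d; rewrite inE => /eqP ->.
  by rewrite cE lsubst_lform AK // lform0 mulr0.
have := pos_coeffs_meval_gt0 p0 ppos vpos.
rewrite pE raddf_sum big_seq big1 ?ltxx // => c /sI [f If fE].
by rewrite /= mevalM -fE (initial_form_vanishes Alow Av) ?mulr0 // IK.
Qed.

End InitialCircuits.

Theorem proposition4p1 (R : realType) (n : nat) (I : ideal R n)
    (hI : linear_ideal I) :
  pos_trop I = pos_bergman (matroid_of_ideal I).
Proof.
apply/seteqP; split=> w; first exact: pos_trop_sub_pos_bergman.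
exact: pos_bergman_sub_pos_trop.
Qed.
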